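(* If $\mathcal{F}$ is a factorization of $\Delta^2$ into positive half-twists in $B_3$, then $\mathcal{F}$ is Hurwitz equivalent to the factorization $(\sigma_1,\sigma_2,\sigma_1,\sigma_1,\sigma_2,\sigma_1)$ of $\Delta^2$.
   Context: $B_3=\langle\sigma_1,\sigma_2:\sigma_1\sigma_2\sigma_1=\sigma_2\sigma_1\sigma_2\rangle$ and $\Delta=\sigma_1\sigma_2\sigma_1$; $\Delta^2$ is central in $B_3$. A positive half-twist is a conjugate of $\sigma_1$ in $B_3$. A factorization of $g$ in a group $G$ is a tuple $(g_1,\dots,g_m)$ of elements of $G$ with $g=g_1\cdots g_m$. A Hurwitz move replaces adjacent factors $(g_j,g_{j+1})$ by $(g_jg_{j+1}g_j^{-1},g_j)$ or by $(g_{j+1},g_{j+1}^{-1}g_jg_{j+1})$. Two factorizations of a central element are Hurwitz equivalent if they are related by a finite sequence of Hurwitz moves and global conjugations $(g_1,\dots,g_m)\mapsto(hg_1h^{-1},\dots,hg_mh^{-1})$, $h\in G$. *)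

(* Defs.v *)
From HB Require Import structures.
From Stdlib Require Import Relation_Operators.
From mathcomp Require Import all_boot.
From mathcomp Require Import boolp.

Set Implicit Arguments.
Unset Strict Implicit.
Unset Printing Implicit Defensive.

Import Algebra.

Local Open Scope group_scope.
Local Open Scope quotient_scope.

(* B3 is the quotient of the words over sigma_1^{+-1}, sigma_2^{+-1} by the
   congruence generated by free cancellation and the braid relation.
   In a letter (s, e), s = false stands for sigma_1 and s = true for sigma_2;
   e = true marks the inverse of the generator.  Classical logic (boolp) makes
   the congruence boolean, as {eq_quot _} requires. *)
Definition letter : Type := (bool * bool)%type.
Definition word : Type := seq letter.

Definition inv_letter (l : letter) : letter := (l.1, ~~ l.2).
Definition inv_word (w : word) : word := rev (map inv_letter w).

Definition w1 : word := [:: (false, false)].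
Definition w2 : word := [:: (true, false)].

Inductive braid_eq : word -> word -> Prop :=
| braid_refl u : braid_eq u u
| braid_sym u v : braid_eq u v -> braid_eq v u
| braid_trans u v w : braid_eq u v -> braid_eq v w -> braid_eq u w
| braid_cat u u' v v' :
    braid_eq u u' -> braid_eq v v' -> braid_eq (u ++ v) (u' ++ v')
| braid_cancel l : braid_eq [:: l; inv_letter l] [::]
| braid_rel : braid_eq (w1 ++ w2 ++ w1) (w2 ++ w1 ++ w2).

Definition braid_eqb (u v : word) : bool := `[< braid_eq u v >].

Lemma braid_eqb_refl : reflexive braid_eqb.
Proof. by move=> u; apply/asboolP/braid_refl. Qed.

Lemma braid_eqb_sym : symmetric braid_eqb.
Proof. by move=> u v; apply/asboolP/asboolP; apply: braid_sym. Qed.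

Lemma braid_eqb_trans : transitive braid_eqb.
Proof.
move=> v u w /asboolP uv /asboolP vw; apply/asboolP; exact: braid_trans uv vw.
Qed.

Canonical braid_eqb_equiv :=
  EquivRel braid_eqb braid_eqb_refl braid_eqb_sym braid_eqb_trans.

Definition B3 : Type := {eq_quot braid_eqb}.
HB.instance Definition _ := Choice.on B3.

Definition B3_of_word (w : word) : B3 := \pi_(B3) w.

Lemma B3_of_wordP u v : B3_of_word u = B3_of_word v <-> braid_eq u v.
Proof.
by split=> [/eqquotP /asboolP|uv] //; apply/eqquotP/asboolP.
Qed.

Definition B3_one : B3 := B3_of_word [::].
Definition B3_mul (x y : B3) : B3 := B3_of_word (repr x ++ repr y).
Definition B3_inv (x : B3) : B3 := B3_of_word (inv_word (repr x)).

Lemma B3_of_wordK (x : B3) : B3_of_word (repr x) = x.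
Proof. exact: reprK. Qed.

Lemma repr_B3_of_word u : braid_eq (repr (B3_of_word u)) u.
Proof. by apply/B3_of_wordP; rewrite B3_of_wordK. Qed.

Lemma B3_mul_word u v : B3_mul (B3_of_word u) (B3_of_word v) = B3_of_word (u ++ v).
Proof. by apply/B3_of_wordP; apply: braid_cat; apply: repr_B3_of_word. Qed.

Lemma braid_eq_mulV u : braid_eq (u ++ inv_word u) [::].
Proof.
elim/last_ind: u => [|u l IH]; first exact: braid_refl.
rewrite /inv_word map_rcons rev_rcons -cats1 -catA -/(inv_word u).
apply: braid_trans IH; apply: braid_cat; first exact: braid_refl.
rewrite -[_ :: inv_word u]cat1s catA -[X in braid_eq _ X]cat0s.
by apply: braid_cat; [apply: braid_cancel | apply: braid_refl].
Qed.

Lemma inv_wordK u : inv_word (inv_word u) = u.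
Proof.
rewrite /inv_word map_rev revK -map_comp map_id_in // => -[s e] _ /=.
by rewrite /inv_letter /= negbK.
Qed.

Lemma B3_mulA : associative B3_mul.
Proof.
move=> x y z; rewrite -(B3_of_wordK x) -(B3_of_wordK y) -(B3_of_wordK z).
by rewrite !B3_mul_word catA.
Qed.

Lemma B3_mul1 : left_id B3_one B3_mul.
Proof. by move=> x; rewrite -(B3_of_wordK x) B3_mul_word. Qed.

Lemma B3_mulr1 : right_id B3_one B3_mul.
Proof. by move=> x; rewrite -(B3_of_wordK x) B3_mul_word cats0. Qed.

Lemma B3_mulrV : right_inverse B3_one B3_inv B3_mul.
Proof.
move=> x; rewrite -{1}(B3_of_wordK x) B3_mul_word.
exact/B3_of_wordP/braid_eq_mulV.
Qed.

Lemma B3_mulV : left_inverse B3_one B3_inv B3_mul.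
Proof.
move=> x; rewrite -{2}(B3_of_wordK x) B3_mul_word.
by apply/B3_of_wordP; rewrite -{2}(inv_wordK (repr x)); apply: braid_eq_mulV.
Qed.

HB.instance Definition _ :=
  isGroup.Build B3 B3_mulA B3_mul1 B3_mulr1 B3_mulV B3_mulrV.

Definition sigma1 : B3 := B3_of_word w1.
Definition sigma2 : B3 := B3_of_word w2.
Definition Delta : B3 := sigma1 * sigma2 * sigma1.

Lemma sigma_braid : sigma1 * sigma2 * sigma1 = sigma2 * sigma1 * sigma2.
Proof.
rewrite /mul /= /sigma1 /sigma2 !B3_mul_word -!catA.
exact/B3_of_wordP/braid_rel.
Qed.

Definition positive_half_twist (x : B3) : Prop :=
  exists h : B3, x = h * sigma1 * h^-1.

Definition factorization (G : groupType) (g : G) (F : seq G) : Prop :=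
  g = \prod_(x <- F) x.

(* The order of multiplication in the product is that of the sequence, and
   conjugation is written out because x ^ y in MathComp is y^-1 * (x * y). *)
Inductive hurwitz_step (G : groupType) : seq G -> seq G -> Prop :=
| hurwitz_move (s t : seq G) (x y : G) :
    hurwitz_step (s ++ x :: y :: t) (s ++ x * y * x^-1 :: x :: t)
| hurwitz_move_inv (s t : seq G) (x y : G) :
    hurwitz_step (s ++ x :: y :: t) (s ++ y :: y^-1 * x * y :: t)
| hurwitz_conj (h : G) (s : seq G) :
    hurwitz_step s [seq h * x * h^-1 | x <- s].

(* The set of steps is stable under reversal, so this reflexive-transitive
   closure is an equivalence relation. *)
Definition hurwitz_equiv (G : groupType) : seq G -> seq G -> Prop :=
  clos_refl_trans (seq G) (@hurwitz_step G).

Lemma Delta2_factorization :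
  factorization (Delta ^+ 2)
    [:: sigma1; sigma2; sigma1; sigma1; sigma2; sigma1].
Proof.
by rewrite /factorization !big_cons big_nil mulg1 expgS expg1 /Delta !mulgA.
Qed.

Lemma Delta2_central (x : B3) : Delta ^+ 2 * x = x * Delta ^+ 2.
Proof.
have D1 : Delta * sigma1 = sigma2 * Delta.
  by rewrite {1}/Delta sigma_braid /Delta !mulgA.
have D2 : Delta * sigma2 = sigma1 * Delta.
  by rewrite /Delta -!mulgA; congr (_ * _); rewrite !mulgA -sigma_braid.
have C1 : commute (Delta ^+ 2) sigma1.
  by rewrite /commute expgS expg1 -mulgA D1 mulgA D2 -mulgA.
have C2 : commute (Delta ^+ 2) sigma2.
  by rewrite /commute expgS expg1 -mulgA D2 mulgA D1 -mulgA.
rewrite -(B3_of_wordK x); elim: (repr x) => [|[s e] w IH].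
  by rewrite -[B3_of_word [::]]/(1 : B3) mulg1 mul1g.
have -> : B3_of_word ((s, e) :: w) = B3_of_word [:: (s, e)] * B3_of_word w.
  by rewrite [RHS]B3_mul_word.
apply: commuteM IH.
have V t : B3_of_word [:: (t, true)] = (B3_of_word [:: (t, false)])^-1.
  apply/esym/mulg1_eq; rewrite [LHS]B3_mul_word.
  exact/B3_of_wordP/(braid_cancel (t, false)).
by case: e; rewrite ?V; first apply: commuteV; case: s.
Qed.

(* Main.v *)
From Stdlib Require Import ZArith Lia Relation_Operators.
Require Import Defs.
From mathcomp Require boolp.
From mathcomp Require Import all_boot.

Set Implicit Arguments.
Unset Strict Implicit.
Unset Printing Implicit Defensive.

Local Open Scope group_scope.

(** The proof turns half-twists into vectors, and Hurwitz equivalence into a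
    question about the directions of six vectors of the plane.

    The group [B3] acts on Z^2 through SL2(Z), with sigma1 acting as the
    transvection along [e1].  A half-twist h sigma1 h^-1 then acts as the
    transvection along its axis h e1, a primitive vector, and it is determined
    by this axis up to sign ([axis_inj]): a Euclidean algorithm on primitive
    vectors rebuilds the half-twist, and the result is equivariant under
    [B3].

    The linear action lifts to an action on vectors with a winding number,
    that is, to the universal cover of the punctured plane.  There every
    element preserves the clockwise order, every half-twist moves points
    clockwise, and Delta^2 is exactly one half-turn.  So the factors of
    Delta^2 together turn every vector by one half-turn and no more.  If the
    axes [v] and [w] of two factors [x] and [y] had |det v w| > 2, then [x y]
    alone would carry [v + w] (signs chosen so that [det v w > 0]) beyond a
    half-turn.  Hence |det v w| <= 2, and when |det v w| = 2 the product [x y]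
    uses up the whole half-turn on [v + w], so that all the other factors fix
    [v + w]: they all equal the half-twist with axis (v + w) / 2
    ([winding_bound]).  Any two factors can be moved to the front, so this
    applies to every pair of them.

    If some pair has |det| = 2, the factorization is thus known up to
    conjugation and is treated by hand ([double_pair_target]).  Otherwise all
    determinants are 0 or +-1, two axes form a basis, and in that basis every
    axis is, up to sign, [e1], [e2] or the same one of [e1 + e2] and
    [e1 - e2]: up to conjugation all factors lie among three half-twists a_i
    with a_i a_(i+1) = delta = sigma1 sigma2 for i modulo 3
    ([triangle_target]).  In a word of length 6 in these letters with product
    Delta^2 = delta^3, some adjacent pair has product delta; Hurwitz moves
    bring it to the front as (sigma1, sigma2), and one repeats with the
    remaining word ([hurwitz_corners]). *)

(** * Actions of the braid group *)

#[local] Arguments Z.mul : simpl never.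
#[local] Arguments Z.add : simpl never.
#[local] Arguments Z.sub : simpl never.
#[local] Arguments Z.opp : simpl never.

Section Action.
Variables (X : Type) (f : letter -> X -> X).
Hypothesis f_cancel : forall l p, f l (f (inv_letter l) p) = p.
Hypothesis f_braid : forall p,
  f (false, false) (f (true, false) (f (false, false) p)) =
  f (true, false) (f (false, false) (f (true, false) p)).

Definition word_act (w : word) (p : X) : X := foldr f p w.
Definition B3_act (g : B3) (p : X) : X := word_act (repr g) p.

Lemma word_act_braid u v : braid_eq u v -> word_act u =1 word_act v.
Proof.
elim=> {u v} [//|u v _ IH p|u v w _ IH1 _ IH2 p|u u' v v' _ IH1 _ IH2 p|l p|p].
- by rewrite IH.
- by rewrite IH1 IH2.
- by rewrite /word_act !foldr_cat -!/(word_act _ _) IH2 IH1.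
- by rewrite /word_act /= f_cancel.
- by rewrite /word_act /= f_braid.
Qed.

Lemma B3_act_word w : B3_act (B3_of_word w) =1 word_act w.
Proof. exact/word_act_braid/repr_B3_of_word. Qed.

Lemma B3_act1 p : B3_act 1 p = p.
Proof. exact: (B3_act_word [::]). Qed.

Lemma B3_actM g h p : B3_act (g * h) p = B3_act g (B3_act h p).
Proof. by rewrite [LHS]B3_act_word /word_act foldr_cat. Qed.

Lemma B3_act_s1 p : B3_act sigma1 p = f (false, false) p.
Proof. exact: B3_act_word. Qed.
Lemma B3_act_s2 p : B3_act sigma2 p = f (true, false) p.
Proof. exact: B3_act_word. Qed.

Lemma B3_actK g p : B3_act g (B3_act g^-1 p) = p.
Proof. by rewrite -B3_actM mulgV B3_act1. Qed.
Lemma B3_actVK g p : B3_act g^-1 (B3_act g p) = p.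
Proof. by rewrite -B3_actM mulVg B3_act1. Qed.
End Action.

(** * The linear action *)

Definition vec : Type := (Z * Z)%type.
Definition det (u v : vec) : Z := (u.1 * v.2 - u.2 * v.1)%Z.
Definition vopp (u : vec) : vec := (- u.1, - u.2)%Z.
Definition addmul (u : vec) (c : Z) (v : vec) : vec :=
  (u.1 + c * v.1, u.2 + c * v.2)%Z.
(** The transvection along [v]. *)
Definition transv (v u : vec) : vec := addmul u (det v u) v.

Definition e1 : vec := (1, 0)%Z.
Definition e2 : vec := (0, 1)%Z.

Definition lin_letter (l : letter) (v : vec) : vec :=
  let c := if l.2 then (-1)%Z else 1%Z in
  if l.1 then (v.1, v.2 - c * v.1)%Z else (v.1 + c * v.2, v.2)%Z.

Lemma vecP (u v : vec) : u.1 = v.1 -> u.2 = v.2 -> u = v.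
Proof. by case: u v => [? ?] [? ?] /= -> ->. Qed.

Lemma vec_nzP (v : vec) : v <> (0, 0)%Z -> (v.1 <> 0 \/ v.2 <> 0)%Z.
Proof.
case: v => x y nz /=; have [x0|] := Z.eq_dec x 0; last by left.
by right=> y0; apply: nz; rewrite x0 y0.
Qed.

Lemma lin_cancel l v : lin_letter l (lin_letter (inv_letter l) v) = v.
Proof. by case: l v => [] [] [] [x y]; rewrite /lin_letter; apply: vecP => /=; lia. Qed.

Lemma lin_braid v :
  lin_letter (false, false) (lin_letter (true, false) (lin_letter (false, false) v)) =
  lin_letter (true, false) (lin_letter (false, false) (lin_letter (true, false) v)).
Proof. by apply: vecP => /=; lia. Qed.

Definition lin : B3 -> vec -> vec := B3_act lin_letter.

Lemma linM g h v : lin (g * h) v = lin g (lin h v).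
Proof. exact: (B3_actM lin_cancel lin_braid). Qed.
Lemma linK g v : lin g (lin g^-1 v) = v.
Proof. exact: (B3_actK lin_cancel lin_braid). Qed.
Lemma linVK g v : lin g^-1 (lin g v) = v.
Proof. exact: (B3_actVK lin_cancel lin_braid). Qed.
Lemma lin1 v : lin 1 v = v.
Proof. exact: (B3_act1 lin_cancel lin_braid). Qed.
Lemma lin_s1 v : lin sigma1 v = (v.1 + v.2, v.2)%Z.
Proof. rewrite [LHS](B3_act_s1 lin_cancel lin_braid); apply: vecP => /=; lia. Qed.
Lemma lin_s2 v : lin sigma2 v = (v.1, v.2 - v.1)%Z.
Proof. rewrite [LHS](B3_act_s2 lin_cancel lin_braid); apply: vecP => /=; lia. Qed.
Lemma lin_Delta v : lin Delta v = (v.2, - v.1)%Z.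
Proof. rewrite !linM !lin_s1 lin_s2 /=; apply: vecP => /=; lia. Qed.
Lemma lin_Delta2 v : lin (Delta ^+ 2) v = vopp v.
Proof. by rewrite expgS expg1 linM !lin_Delta. Qed.

Lemma det_lin g u v : det (lin g u) (lin g v) = det u v.
Proof.
rewrite /lin /B3_act; elim: (repr g) => //= l w <-.
move: (word_act _ w u) (word_act _ w v) => {u v} [a b] [c d].
by case: l => [] [] []; rewrite /det /lin_letter /=; lia.
Qed.

Lemma lin_addmul g u c v : lin g (addmul u c v) = addmul (lin g u) c (lin g v).
Proof.
rewrite /lin /B3_act; elim: (repr g) => //= l w ->.
move: (word_act _ w u) (word_act _ w v) => {u v} [a b] [a' b'].
by case: l => [] [] []; apply: vecP; rewrite /lin_letter /=; lia.
Qed.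

Lemma Delta_s1 : Delta * sigma1 = sigma2 * Delta.
Proof. by rewrite {1}/Delta sigma_braid /Delta !mulgA. Qed.
Lemma Delta_s2 : Delta * sigma2 = sigma1 * Delta.
Proof.
by rewrite /Delta -!mulgA; congr (_ * _); rewrite !mulgA -sigma_braid.
Qed.

(** Delta and sigma1 are more convenient than the standard generators: Delta
    acts on the plane as a quarter turn, and sigma1 fixes the horizontal axis. *)
Lemma B3_ind (P : B3 -> Prop) :
  P 1 -> (forall g, P g -> P (sigma1 * g)) -> (forall g, P g -> P (sigma1^-1 * g)) ->
  (forall g, P g -> P (Delta * g)) -> (forall g, P g -> P (Delta^-1 * g)) ->
  forall g, P g.
Proof.
move=> P1 Ps Pv PD PDv g; rewrite -(B3_of_wordK g).
elim: (repr g) => [//|[s e] w IH].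
have -> : B3_of_word ((s, e) :: w) = B3_of_word [:: (s, e)] * B3_of_word w.
  by rewrite [RHS]B3_mul_word.
have V t : B3_of_word [:: (t, true)] = (B3_of_word [:: (t, false)])^-1.
  apply/esym/mulg1_eq; rewrite [LHS]B3_mul_word.
  exact/B3_of_wordP/(braid_cancel (t, false)).
have s2E : sigma2 = Delta * (sigma1 * Delta^-1) by rewrite mulgA Delta_s1 mulgK.
have s2VE : sigma2^-1 = Delta * (sigma1^-1 * Delta^-1).
  by apply: mulg1_eq; rewrite 2!mulgA -Delta_s1 mulgK mulgV.
case: e s => -[]; rewrite ?V -/sigma1 -/sigma2.
- by rewrite s2VE -(mulgA Delta) -(mulgA sigma1^-1); apply/PD/Pv/PDv.
- exact: Pv.
- by rewrite s2E -(mulgA Delta) -(mulgA sigma1); apply/PD/Ps/PDv.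
- exact: Ps.
Qed.

(** * Half-twists and primitive vectors *)

Definition cnj (h x : B3) : B3 := h * x * h^-1.

Lemma conjM_act g h x : cnj (g * h) x = cnj g (cnj h x).
Proof. by rewrite /cnj invgM !mulgA. Qed.
Lemma conj_mul h x y : cnj h (x * y) = cnj h x * cnj h y.
Proof. by rewrite /cnj !mulgA mulgVK. Qed.
Lemma conj1 x : cnj 1 x = x.
Proof. by rewrite /cnj mul1g invg1 mulg1. Qed.
Lemma conjVK h x : cnj h^-1 (cnj h x) = x.
Proof. by rewrite -conjM_act mulVg conj1. Qed.
Lemma conj_comm h x : h * x = x * h -> cnj h x = x.
Proof. by rewrite /cnj => ->; rewrite mulgK. Qed.
Lemma conj_id x : cnj x x = x.
Proof. exact: conj_comm. Qed.
Lemma conj_intro h x y : h * x = y * h -> cnj h x = y.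
Proof. by rewrite /cnj => ->; rewrite mulgK. Qed.
Lemma conj_Delta2 x : cnj (Delta ^+ 2) x = x.
Proof. exact/conj_comm/Delta2_central. Qed.
Lemma conj_Delta2r g : cnj g (Delta ^+ 2) = Delta ^+ 2.
Proof. exact/conj_comm/esym/Delta2_central. Qed.

(** The half-twist whose axis is the nonnegative primitive vector (a, b), by the
    subtractive Euclidean algorithm: (a, b) = sigma1 (a - b, b) when [b <= a],
    and (a, b) = sigma2^-1 (a, b - a) otherwise.  The first argument is fuel. *)
Fixpoint euclid_twist (n : nat) (a b : Z) : B3 :=
  if n is n'.+1 then
    if (b =? 0)%Z then sigma1 else
    if (a =? 0)%Z then sigma2 else
    if (b <=? a)%Z then cnj sigma1 (euclid_twist n' (a - b) b)
    else cnj sigma2^-1 (euclid_twist n' a (b - a))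
  else sigma1.

Definition quadrant_twist (a b : Z) : B3 :=
  euclid_twist (Z.to_nat (a + b)) a b.

(** Depends on [v] only up to sign.  Vectors of the open second and fourth
    quadrants are images under Delta, a quarter turn, of vectors of the first
    and third ones. *)
Definition twist (v : vec) : B3 :=
  if (0 <=? v.1 * v.2)%Z then quadrant_twist (Z.abs v.1) (Z.abs v.2)
  else cnj Delta (quadrant_twist (Z.abs v.2) (Z.abs v.1)).

Lemma euclid_twist_fuel n m a b :
  (0 <= a)%Z -> (0 <= b)%Z -> (a + b <= Z.of_nat n)%Z ->
  (a + b <= Z.of_nat m)%Z -> (0 < a + b)%Z -> euclid_twist n a b = euclid_twist m a b.
Proof.
elim: n m a b => [|n IH] [|m] a b a0 b0 le_n le_m ab; [lia|lia|lia|] => /=.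
case: Z.eqb_spec => // bn0; case: Z.eqb_spec => // an0.
by case: Z.leb_spec => ab'; congr (cnj _ _); apply: IH; lia.
Qed.

Lemma quadrant_twist0r a : (0 < a)%Z -> quadrant_twist a 0 = sigma1.
Proof.
by rewrite /quadrant_twist => a0; case E: (Z.to_nat _) => [|n] //=; lia.
Qed.

Lemma quadrant_twist0l b : (0 < b)%Z -> quadrant_twist 0 b = sigma2.
Proof.
rewrite /quadrant_twist => a0; case E: (Z.to_nat _) => [|n] /=; first lia.
by case: Z.eqb_spec => //; lia.
Qed.

Lemma quadrant_twistDl a b : (0 <= a)%Z -> (0 < b)%Z ->
  quadrant_twist (a + b) b = cnj sigma1 (quadrant_twist a b).
Proof.
move=> a0 b0; rewrite {1}/quadrant_twist.
case E: (Z.to_nat _) => [|n] /=; first lia.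
case: Z.eqb_spec => [|_]; first lia.
case: Z.eqb_spec => [|_]; first lia.
case: Z.leb_spec => [_|]; last lia.
rewrite (_ : a + b - b = a)%Z; last lia.
by congr (cnj _ _); apply: euclid_twist_fuel; lia.
Qed.

Lemma quadrant_twistDr a b : (0 < a)%Z -> (0 < b)%Z ->
  quadrant_twist a (a + b) = cnj sigma2^-1 (quadrant_twist a b).
Proof.
move=> a0 b0; rewrite {1}/quadrant_twist.
case E: (Z.to_nat _) => [|n] /=; first lia.
case: Z.eqb_spec => [|_]; first lia.
case: Z.eqb_spec => [|_]; first lia.
case: Z.leb_spec => [|_]; first lia.
rewrite (_ : a + b - a = b)%Z; last lia.
by congr (cnj _ _); apply: euclid_twist_fuel; lia.
Qed.

(** Crossing back to the first quadrant produces Delta^2, which is central;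
    the coordinate axes match because Delta exchanges sigma1 and sigma2. *)
Lemma twist_Delta v : v <> (0, 0)%Z -> twist (lin Delta v) = cnj Delta (twist v).
Proof.
case: v => x y nz; rewrite lin_Delta /twist /= Z.abs_opp.
case: (Z.leb_spec 0 (x * y)) => xy; last first.
  case: Z.leb_spec => [_|]; last lia.
  by rewrite -conjM_act -expg2 conj_Delta2.
have [y0|ny0] := Z.eq_dec y 0.
  have ? : x <> 0%Z by move=> x0; apply: nz; rewrite x0 y0.
  case: Z.leb_spec => [_|]; last nia.
  rewrite y0 Z.abs_0 quadrant_twist0r; last lia.
  by rewrite quadrant_twist0l; [rewrite (conj_intro Delta_s1)|lia].
have [x0|nx0] := Z.eq_dec x 0.
  case: Z.leb_spec => [_|]; last nia.
  rewrite x0 Z.abs_0 quadrant_twist0r; last lia.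
  by rewrite quadrant_twist0l; [rewrite (conj_intro Delta_s2)|lia].
by case: Z.leb_spec => [|_]; first nia.
Qed.

(** In the quadrants where x y >= 0 this is a step of the algorithm.  In the
    other two, sigma1 undoes a step, possibly leaving the quadrant, and the
    required identities are sigma1 Delta sigma1 = sigma2^-1 Delta^2 and
    sigma1 Delta sigma2^-1 = Delta. *)
Lemma twist_s1 v : v <> (0, 0)%Z -> twist (lin sigma1 v) = cnj sigma1 (twist v).
Proof.
case: v => x y nz; rewrite lin_s1 /twist /=.
have [y0|ny0] := Z.eq_dec y 0.
  have ? : x <> 0%Z by move=> x0; apply: nz; rewrite x0 y0.
  rewrite y0 !Z.mul_0_r /= Z.add_0_r quadrant_twist0r; last lia.
  by rewrite conj_id.
case: (Z.leb_spec 0 (x * y)) => xy.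
  case: Z.leb_spec => [_|]; last nia.
  rewrite (_ : Z.abs (x + y) = Z.abs x + Z.abs y)%Z; last nia.
  by apply: quadrant_twistDl; lia.
have D : Z.abs (x + y) = Z.abs (Z.abs y - Z.abs x) by nia.
have [yx|xy'] := Z.le_gt_cases (Z.abs x) (Z.abs y).
  case: Z.leb_spec => [_|]; last nia.
  set a := (Z.abs y - Z.abs x)%Z; have -> : Z.abs (x + y) = a by lia.
  have -> : Z.abs y = (a + Z.abs x)%Z by lia.
  rewrite quadrant_twistDl; [|lia|nia].
  have -> : quadrant_twist a (a + Z.abs x) =
            cnj sigma2^-1 (quadrant_twist a (Z.abs x)).
    have [a0|na0] := Z.eq_dec a 0; last by apply: quadrant_twistDr; nia.
    rewrite a0 Z.add_0_l quadrant_twist0l; last nia.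
    by rewrite conj_comm // mulVg mulgV.
  rewrite -[in RHS]conjM_act -[in RHS]conjM_act.
  rewrite -[in LHS](conj_Delta2 (quadrant_twist _ _)) -conjM_act.
  congr (cnj _ _); rewrite expg2 mulgA.
  by rewrite {1}/Delta sigma_braid -!mulgA mulKg -Delta_s1 !mulgA.
case: Z.leb_spec => [|_]; first nia.
set a := (Z.abs x - Z.abs y)%Z; have -> : Z.abs (x + y) = a by lia.
have -> : Z.abs x = (Z.abs y + a)%Z by lia.
rewrite quadrant_twistDr; [|lia|lia].
by rewrite -[in RHS]conjM_act -conjM_act -Delta_s2 mulgK.
Qed.

Lemma lin_nz g v : v <> (0, 0)%Z -> lin g v <> (0, 0)%Z.
Proof.
move=> nz E; apply: nz; rewrite -(linVK g v) E.
by have := lin_addmul g^-1 (0, 0)%Z (-1) (0, 0)%Z; case: (lin _ _) => a b [] *;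
  apply: vecP => /=; lia.
Qed.

(** This is what makes a half-twist a function of its axis: it says that [h e1]
    determines [h sigma1 h^-1]. *)
Lemma twist_lin g v : v <> (0, 0)%Z -> twist (lin g v) = cnj g (twist v).
Proof.
move=> nz; elim/B3_ind: g => [|g IH|g IH|g IH|g IH]; first by rewrite lin1 conj1.
- by rewrite linM conjM_act twist_s1 ?IH //; apply: lin_nz.
- rewrite linM conjM_act -IH -[LHS](conjVK sigma1) -twist_s1 ?linK //.
  by do 2!apply: lin_nz.
- by rewrite linM conjM_act twist_Delta ?IH //; apply: lin_nz.
- rewrite linM conjM_act -IH -[LHS](conjVK Delta) -twist_Delta ?linK //.
  by do 2!apply: lin_nz.
Qed.

Definition axis (x : B3) (v : vec) : Prop :=
  exists2 h, x = cnj h sigma1 & v = lin h e1.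

Lemma axis_twist x v : axis x v -> x = twist v.
Proof. by case=> h -> ->; rewrite twist_lin. Qed.

Lemma axis_inj x y v : axis x v -> axis y v -> x = y.
Proof. by move=> /axis_twist -> /axis_twist ->. Qed.

Lemma axis_conj g x v : axis x v -> axis (cnj g x) (lin g v).
Proof. by case=> h -> ->; exists (g * h); rewrite ?conjM_act ?linM. Qed.

(** Delta^2 acts as -1 but is central. *)
Lemma axis_opp x v : axis x v -> axis x (vopp v).
Proof. by rewrite -lin_Delta2 => /(axis_conj (Delta ^+ 2)); rewrite conj_Delta2. Qed.

Lemma axis_s1 : axis sigma1 e1.
Proof. by exists 1; rewrite ?conj1 ?lin1. Qed.

Lemma axis_s2 : axis sigma2 e2.
Proof.
by move: (axis_opp (axis_conj Delta axis_s1)); rewrite (conj_intro Delta_s1) lin_Delta.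
Qed.

Lemma axis_prim x v : axis x v -> exists u, det v u = 1%Z.
Proof. by case=> h _ ->; exists (lin h e2); rewrite det_lin. Qed.

Lemma axis_half x v : axis x v -> positive_half_twist x.
Proof. by case=> h -> _; exists h. Qed.

Lemma half_axis x : positive_half_twist x -> exists v, axis x v.
Proof. by case=> h ->; exists (lin h e1), h. Qed.

(** Transport of the formula for sigma1 by [h], which preserves determinants. *)
Lemma axis_transv x v u : axis x v -> lin x u = transv v u.
Proof.
case=> h -> ->; rewrite /cnj 2!linM; move: (lin h^-1 u) (linK h u) => w <-.
rewrite lin_s1 /transv det_lin -lin_addmul; congr (lin h _).
by apply: vecP; rewrite /det /=; lia.
Qed.

(** * The winding action *)

(** The half-plane of the directions in [0, pi). *)
Definition up (v : vec) : bool := (0 <? v.2)%Z || (v.2 =? 0)%Z && (0 <? v.1)%Z.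

(** A vector together with the number of clockwise half-turns made so far. *)
Definition point : Type := (Z * vec)%type.

(** The generators turn vectors clockwise, by less than a half-turn, and their
    inverses turn them back, so the winding number changes, by one, exactly when
    the vector changes half-plane. *)
Definition lift_letter (l : letter) (p : point) : point :=
  let v := lin_letter l p.2 in
  (if Bool.eqb (up p.2) (up v) then p.1 else if l.2 then p.1 - 1 else p.1 + 1, v)%Z.

(** The winding number has the parity prescribed by the half-plane; these are
    the points of the universal cover of the punctured plane. *)
Definition consistent (p : point) : Prop := p.2 <> (0, 0)%Z /\ Z.even p.1 = up p.2.

(** The clockwise order of directions.  On consistent points with the same
    winding number both vectors lie in the same half-plane, so the sign of the
    determinant compares their directions. *)
Definition pt_le (p q : point) : Prop :=
  (p.1 < q.1)%Z \/ p.1 = q.1 /\ (0 <= det q.2 p.2)%Z.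

Lemma upP v : reflect (0 < v.2 \/ v.2 = 0 /\ 0 < v.1)%Z (up v).
Proof.
apply: (iffP idP); rewrite /up.
  case/orP; first by move/Z.ltb_lt; left.
  by case/andP => /Z.eqb_eq ? /Z.ltb_lt ?; right.
case=> [/Z.ltb_lt ->//|[/Z.eqb_eq -> /Z.ltb_lt ->]]; exact: orbT.
Qed.

Lemma lift_cancel l p : lift_letter l (lift_letter (inv_letter l) p) = p.
Proof.
rewrite /lift_letter /= lin_cancel.
case: p => k v /=; congr pair; move: (lin_letter _ _) => w.
by case: (up v); case: (up w); case: l => ? [] //=; lia.
Qed.

Lemma lift_braid p :
  lift_letter (false, false) (lift_letter (true, false) (lift_letter (false, false) p)) =
  lift_letter (true, false) (lift_letter (false, false) (lift_letter (true, false) p)).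
Proof.
rewrite /lift_letter /= lin_braid; case: p => k [x y] /=; congr pair.
rewrite /lin_letter /=.
do !(case: upP => /= ?); lia.
Qed.

Definition lift_act : B3 -> point -> point := B3_act lift_letter.

Lemma liftM g h p : lift_act (g * h) p = lift_act g (lift_act h p).
Proof. exact: (B3_actM lift_cancel lift_braid). Qed.
Lemma liftK g p : lift_act g (lift_act g^-1 p) = p.
Proof. exact: (B3_actK lift_cancel lift_braid). Qed.
Lemma lift1 p : lift_act 1 p = p.
Proof. exact: (B3_act1 lift_cancel lift_braid). Qed.

Lemma lift_lin g p : (lift_act g p).2 = lin g p.2.
Proof. by rewrite /lift_act /lin /B3_act; elim: (repr g) => //= l w <-. Qed.

Lemma lift_s1 k v : lift_act sigma1 (k, v) = (k, lin sigma1 v).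
Proof.
rewrite [LHS](B3_act_s1 lift_cancel lift_braid) lin_s1 /lift_letter /=.
congr pair; last by apply: vecP => /=; lia.
by rewrite /lin_letter /=; do !(case: upP => /= ?); lia.
Qed.

Lemma lift_s2 k v :
  lift_act sigma2 (k, v) = ((if Bool.eqb (up v) (up (lin sigma2 v)) then k else k + 1)%Z, lin sigma2 v).
Proof.
have -> : lin sigma2 v = lin_letter (true, false) v.
  exact: (B3_act_s2 lin_cancel lin_braid).
exact: (B3_act_s2 lift_cancel lift_braid).
Qed.

Lemma lift_Delta2 k v : v <> (0, 0)%Z ->
  lift_act (Delta ^+ 2) (k, v) = ((k + 1)%Z, vopp v).
Proof.
case: v => x y nz.
have {nz} /= nz := vec_nzP nz.
rewrite expg2 /Delta !liftM !(lift_s1, lift_s2, lin_s1, lin_s2) /=.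
congr pair; last by apply: vecP => /=; lia.
do !(case: upP => /= ?); lia.
Qed.

Lemma even_next k : Z.even (k + 1) = ~~ Z.even k.
Proof. by rewrite Z.add_1_r Z.even_succ -Z.negb_even. Qed.

Lemma even_prev k : Z.even (k - 1) = ~~ Z.even k.
Proof. by rewrite -{2}(Z.sub_add 1 k) even_next negbK. Qed.

Lemma consistent_lift g p : consistent p -> consistent (lift_act g p).
Proof.
case=> nz e; split; first by rewrite lift_lin; apply: lin_nz.
rewrite /lift_act /B3_act; elim: (repr g) => //= l w.
move: (word_act _ w p) => q {p nz e}; rewrite /lift_letter /=.
by case: (up (lin_letter l q.2)); case: (up q.2); case: l.2;
  rewrite /= ?even_next ?even_prev => ->.
Qed.

Lemma lift_Delta k v :
  lift_act Delta (k, v) =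
  ((if Bool.eqb (up v) (up (lin Delta v)) then k else k + 1)%Z, lin Delta v).
Proof.
case: v => x y.
rewrite lin_Delta /Delta !liftM !(lift_s1, lift_s2, lin_s1, lin_s2) /=.
congr pair; last by apply: vecP => /=; lia.
do !(case: upP => /= ?); lia.
Qed.

Lemma mul_ge0 a b : (0 <= a /\ 0 <= b \/ a <= 0 /\ b <= 0 -> 0 <= a * b)%Z.
Proof. nia. Qed.

(** Determinants are preserved, so only changes of the winding number matter;
    these are read off from the quadrants of the two vectors, as Delta is a
    quarter turn. *)
Lemma le_Delta p q : consistent p -> consistent q -> pt_le p q ->
  pt_le (lift_act Delta p) (lift_act Delta q).
Proof.
case: p q => k v [k' v'] [/= nz e] [/= nz' e'].
rewrite /pt_le !lift_Delta !det_lin /= => lepq.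
have [kk|?] := Z.eq_dec k' (k + 1).
  have: up v' = ~~ up v by rewrite -e -e' kk even_next.
  move: v v' lepq nz nz' {e e'} => [x y] [x' y'].
  rewrite !lin_Delta /det => /= lepq /vec_nzP /= nz /vec_nzP /= nz'.
  case: (upP (x', y')) => /= ?; case: (upP (x, y)) => /= ? // _;
  case: (upP (y, - x)%Z) => /= ?; case: (upP (y', - x')%Z) => /= ?;
  try (left; lia); try (exfalso; lia).
    by have := @mul_ge0 x' y; have := @mul_ge0 y' (- x); right; lia.
  by have := @mul_ge0 x' y; have := @mul_ge0 y' (- x); right; lia.
have [kk|?] := Z.eq_dec k k'; last by left; case: ifP => _; case: ifP => _; lia.
have: up v' = up v by rewrite -e -e' kk.
move: v v' lepq nz nz' {e e'} => [x y] [x' y'].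
rewrite !lin_Delta /det => /= lepq /vec_nzP /= nz /vec_nzP /= nz'.
case: (upP (x', y')) => /= ?; case: (upP (x, y)) => /= ? // _;
  case: (upP (y, - x)%Z) => /= ?; case: (upP (y', - x')%Z) => /= ?;
  by (left; lia) || (right; lia).
Qed.

Lemma consistent_nz p : consistent p -> p.2 <> (0, 0)%Z. Proof. by case. Qed.

Lemma liftVK g p : lift_act g^-1 (lift_act g p) = p.
Proof. by rewrite -liftM mulVg lift1. Qed.

Lemma lift_s1V k v : lift_act sigma1^-1 (k, v) = (k, lin sigma1^-1 v).
Proof. by rewrite -{1}(linK sigma1 v) -lift_s1 liftVK. Qed.

(** The inverse of Delta^2, see [lift_Delta2]. *)
Definition back (p : point) : point := (p.1 - 1, vopp p.2)%Z.

Lemma vopp_nz v : v <> (0, 0)%Z -> vopp v <> (0, 0)%Z.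
Proof. by rewrite -lin_Delta2; apply: lin_nz. Qed.

Lemma voppK v : vopp (vopp v) = v.
Proof. by apply: vecP => /=; lia. Qed.

Lemma lift_DeltaV p : consistent p -> lift_act Delta^-1 p = lift_act Delta (back p).
Proof.
case: p => k v /consistent_nz /= nz.
rewrite -{1}(_ : lift_act (Delta ^+ 2) (back (k, v)) = (k, v)).
  by rewrite expg2 liftM liftVK.
by rewrite lift_Delta2 ?voppK ?Z.sub_add //; apply: vopp_nz.
Qed.

Lemma up_opp v : v <> (0, 0)%Z -> up (vopp v) = ~~ up v.
Proof.
case: v => x y /vec_nzP /= nz.
by case: upP => /= ?; case: upP => /= ? //; lia.
Qed.

Lemma consistent_back p : consistent p -> consistent (back p).
Proof.
case: p => k v [/= nz e]; split=> /=; first exact: vopp_nz.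
by rewrite even_prev e up_opp.
Qed.

Lemma le_back p q : pt_le p q -> pt_le (back p) (back q).
Proof. by rewrite /pt_le /back /det /=; lia. Qed.

Lemma le_lift g p q : consistent p -> consistent q -> pt_le p q ->
  pt_le (lift_act g p) (lift_act g q).
Proof.
move=> gp gq lepq; elim/B3_ind: g => [|g IH|g IH|g IH|g IH];
  rewrite ?lift1 ?(liftM _ g p) ?(liftM _ g q) //.
- by move: (lift_act g p) (lift_act g q) IH => [? ?] [? ?]; rewrite /pt_le !lift_s1 det_lin.
- by move: (lift_act g p) (lift_act g q) IH => [? ?] [? ?]; rewrite /pt_le !lift_s1V det_lin.
- by apply: le_Delta => //; apply: consistent_lift.
- have [gp' gq'] := (consistent_lift g gp, consistent_lift g gq).
  rewrite !lift_DeltaV //; apply: le_Delta; [exact: consistent_back..|exact: le_back].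
Qed.

(** By monotonicity this reduces to sigma1, which does not change the winding
    number and satisfies det (sigma1 v) v = v_2^2. *)
Lemma le_half x p : positive_half_twist x -> consistent p -> pt_le p (lift_act x p).
Proof.
case=> h -> gp; rewrite 2!liftM -{1}(liftK h p).
have gq := consistent_lift h^-1 gp; apply: le_lift => //; first exact: consistent_lift.
case: (lift_act _ _) => k v; rewrite lift_s1 /pt_le lin_s1 /det /=; nia.
Qed.

(** [v.2 * det w u = u.2 * det w v + w.2 * det v u], and second coordinates are
    nonnegative in this half-plane. *)
Lemma det_trans v u w : up u -> up v -> up w ->
  (0 <= det v u -> 0 <= det w v -> 0 <= det w u)%Z.
Proof.
move: u v w => [x y] [x' y'] [x'' y''] /upP /= hu /upP /= hv /upP /= hw.
rewrite /det /= => d d'.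
have [y'0|?] := Z.eq_dec y' 0.
  have ? : y'' = 0%Z by rewrite y'0 in d'; nia.
  by have := @mul_ge0 x'' y; lia.
have := @mul_ge0 y (x'' * y' - y'' * x'); have := @mul_ge0 y'' (x' * y - y' * x).
have E : (y' * (x'' * y - y'' * x) =
          y * (x'' * y' - y'' * x') + y'' * (x' * y - y' * x))%Z by lia.
move=> h1 h2; apply: (proj1 (Z.mul_nonneg_cancel_l y' _ _)); first lia.
by rewrite E; lia.
Qed.

Lemma pt_le_trans q p r : consistent p -> consistent q -> consistent r ->
  pt_le p q -> pt_le q r -> pt_le p r.
Proof.
case: p q r => k u [k' v] [k'' w].
case=> /= nu eu [/= nv ev] [/= nw ew].
rewrite /pt_le /= => -[lt1|[kk d]] [lt2|[kk' d']]; [left; lia..|right; split; first lia].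
have uv : up v = up u by rewrite -eu -ev kk.
have uw : up w = up u by rewrite -eu -ew kk kk'.
case U: (up u); first by apply: (@det_trans v); rewrite ?uv ?uw ?U.
rewrite -[det w u](_ : det (vopp w) (vopp u) = _); last by rewrite /det /=; lia.
by apply: (@det_trans (vopp v)); rewrite ?up_opp ?uv ?uw ?U //; move: d d';
  rewrite /det /=; lia.
Qed.

(** * Pairs of half-twists in a factorization of Delta^2 *)

Definition half_twists (F : seq B3) : Prop := {in F, forall x, positive_half_twist x}.

Definition product (F : seq B3) : B3 := \prod_(x <- F) x.

Lemma product_cons x F : product (x :: F) = x * product F. Proof. exact: big_cons. Qed.
Lemma product_nil : product [::] = 1. Proof. exact: big_nil. Qed.
Lemma product_cat F F' : product (F ++ F') = product F * product F'. Proof. exact: big_cat. Qed.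

Lemma half_twists_cons x F :
  half_twists (x :: F) <-> positive_half_twist x /\ half_twists F.
Proof.
split=> [h|[hx hF] y]; last by rewrite inE => /predU1P [->|/hF].
by split=> [|y yF]; apply: h; rewrite inE ?eqxx ?yF ?orbT.
Qed.

Lemma le_prod F p : half_twists F -> consistent p -> pt_le p (lift_act (product F) p).
Proof.
elim: F => [|x F IH] h gp; first by rewrite product_nil lift1 /pt_le /det; lia.
case/half_twists_cons: h => hx hF; rewrite product_cons liftM.
have gq := consistent_lift (product F) gp.
by apply: pt_le_trans (IH hF gp) (le_half hx gq) => //; apply: consistent_lift.
Qed.

(** The factors can only move [p] forward, so if the product does not, none of
    them does; and a transvection fixes [p] only when its axis is parallel to
    it. *)
Lemma product_fix F p : half_twists F -> consistent p -> pt_le (lift_act (product F) p) p ->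
  forall x v, x \in F -> axis x v -> det v p.2 = 0%Z.
Proof.
move=> h gp; elim: F h => [//|x F IH] /half_twists_cons [hx hF].
rewrite product_cons liftM; set q := lift_act (product F) p => le_xq.
have gq : consistent q := consistent_lift (product F) gp.
have le_pq : pt_le p q := le_prod hF gp.
have le_qx : pt_le q (lift_act x q) := le_half hx gq.
have gxq := consistent_lift x gq.
have fixF := IH hF (pt_le_trans gq gxq gp le_qx le_xq).
have qE : q.2 = p.2.
  rewrite /q lift_lin.
  have: {in F, forall y v, axis y v -> det v p.2 = 0%Z} by move=> y yF v; apply: fixF.
  elim: F hF {IH fixF q le_xq gq le_pq le_qx gxq} => [|y F IH]; first by rewrite product_nil lin1.
  case/half_twists_cons=> hy hF fix_y.
  rewrite product_cons linM IH //; last by move=> z zF; apply: fix_y; rewrite inE zF orbT.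
  have [w yw] := half_axis hy; rewrite (axis_transv _ yw) /transv.
  rewrite (fix_y y _ w yw) ?inE ?eqxx //.
  by apply: vecP => /=; lia.
have le_xp := pt_le_trans gp gq gxq le_pq le_qx.
move=> y v; rewrite inE => /predU1P [->|]; last exact: fixF.
move=> xv; move: le_xp le_xq; rewrite /pt_le lift_lin (axis_transv _ xv) qE.
case: (lift_act x q) => k u /=; rewrite /transv /addmul /det /=; nia.
Qed.

(** The test point [v + w] for the axes [v = e1] and [w = (a, b)] of the first
    two factors.  By centrality [Q] may be applied last, so
    [sigma1 y (v + w)] lies before the half-turn of [v + w].  The vector
    [y (v + w)] has negative second coordinate [b - b^2], hence winding number
    at least 1, and comparing the directions leaves [b^2 (2 - b) >= 0].  When
    [b = 2] the half-turn is reached before [Q] is applied, and [product_fix]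
    applies. *)
Lemma winding_bound a b y Q :
  axis y (a, b) -> half_twists Q -> sigma1 * y * product Q = Delta ^+ 2 -> (0 <= b)%Z ->
  (b <= 2)%Z /\ (b = 2%Z -> forall z v, z \in Q -> axis z v -> det v (a + 1, b)%Z = 0%Z).
Proof.
move=> yv hQ E b0.
have [b1|b2] := Z.le_gt_cases b 1; first by split; lia.
have {}E : product Q * (sigma1 * y) = Delta ^+ 2.
  by rewrite -[RHS](conj_Delta2r (sigma1 * y)^-1) -E /cnj invgK mulKg.
pose p : point := (0%Z, (a + 1, b)%Z).
have gp : consistent p.
  by split=> /=; [case; lia|case: upP => //= ?; lia].
have gq := consistent_lift (sigma1 * y) gp.
have := le_prod hQ gq; rewrite -liftM E lift_Delta2 /=; last exact: consistent_nz gp.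
have := le_half (axis_half yv) gp.
have := consistent_lift y gp.
case yp : (lift_act y p) => [k u].
have uE : u = (a + 1 - b * a, b - b * b)%Z.
  move: (lift_lin y p); rewrite yp /= (axis_transv _ yv) /transv /det /= => ->.
  by apply: vecP => /=; lia.
have qE : lift_act (sigma1 * y) p = (k, (u.1 + u.2, u.2)%Z).
  by rewrite liftM yp lift_s1 lin_s1.
rewrite qE => -[/= _ ek] le_py le_qp.
have k_odd : Z.even k = false by rewrite ek; case: upP => //; rewrite uE /=; nia.
have k_nz : k <> 0%Z by move=> k0; rewrite k0 in k_odd.
have k1 : k = 1%Z by move: le_py le_qp; rewrite /pt_le /=; lia.
have b_le2 : (b <= 2)%Z.
  have : (0 <= b * b * (2 - b))%Z by move: le_qp; rewrite /pt_le uE k1 /det /=; lia.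
  case: (Z.le_gt_cases b 2) => // b3.
  have := @mul_ge0 (b - 3) (b + 3); have := @mul_ge0 (b * b - 9) (b - 3); lia.
split=> // b_eq2 z v zQ zv.
have q2E : (lift_act (sigma1 * y) p).2 = vopp p.2.
  by rewrite qE uE b_eq2; apply: vecP => /=; lia.
have := product_fix hQ gq _ zQ zv; rewrite -liftM E lift_Delta2; last exact: consistent_nz gp.
rewrite q2E qE uE k1 b_eq2 /pt_le /det /=; lia.
Qed.

(** * Degree *)

Definition degree_letter (l : letter) (n : Z) : Z := (if l.2 then n - 1 else n + 1)%Z.

(** The abelianization of the braid group. *)
Definition degree (g : B3) : Z := B3_act degree_letter g 0%Z.

Lemma degree_cancel l n : degree_letter l (degree_letter (inv_letter l) n) = n.
Proof. by case: l => ? []; rewrite /degree_letter /=; lia. Qed.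

Lemma degreeM g h : degree (g * h) = (degree g + degree h)%Z.
Proof.
rewrite {1}/degree (B3_actM degree_cancel) // -/(degree h).
move: (degree h) => n; rewrite /degree /B3_act.
elim: (repr g) => //= l w ->; rewrite /degree_letter; case: l.2; lia.
Qed.

Lemma degree_s1 : degree sigma1 = 1%Z.
Proof. by rewrite /degree (B3_act_s1 degree_cancel). Qed.
Lemma degree_s2 : degree sigma2 = 1%Z.
Proof. by rewrite /degree (B3_act_s2 degree_cancel). Qed.
Lemma degree1 : degree 1 = 0%Z.
Proof. by rewrite /degree (B3_act1 degree_cancel). Qed.

Lemma degree_half x : positive_half_twist x -> degree x = 1%Z.
Proof.
case=> h ->; rewrite 2!degreeM degree_s1.
have := degreeM h h^-1; rewrite mulgV degree1; lia.
Qed.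

Lemma degree_prod F : half_twists F -> degree (product F) = Z.of_nat (size F).
Proof.
elim: F => [_|x F IH]; first by rewrite product_nil degree1.
by case/half_twists_cons => hx /IH E; rewrite product_cons degreeM E degree_half //=; lia.
Qed.

Definition twist_factorization (F : seq B3) : Prop := factorization (Delta ^+ 2) F /\ half_twists F.

Lemma full_size F : twist_factorization F -> size F = 6.
Proof.
case=> E hF; have := degree_prod hF; rewrite /product -E expg2 degreeM /Delta !degreeM.
rewrite degree_s1 degree_s2; lia.
Qed.

(** * Hurwitz moves *)

#[local] Notation hurwitz := (@hurwitz_equiv B3).

Lemma hurwitz_refl F : hurwitz F F. Proof. exact: rt_refl. Qed.

Lemma hurwitz_trans F' F F'' : hurwitz F F' -> hurwitz F' F'' -> hurwitz F F''.
Proof. exact: rt_trans. Qed.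

Lemma half_conj h x : positive_half_twist x -> positive_half_twist (cnj h x).
Proof. by case=> g ->; exists (h * g); rewrite -/(cnj g _) -conjM_act. Qed.

Lemma product_conj h F : product [seq cnj h x | x <- F] = cnj h (product F).
Proof.
elim: F => [|x F IH] /=; first by rewrite product_nil conj_comm ?mulg1 ?mul1g.
by rewrite !product_cons IH conj_mul.
Qed.

Lemma full_hurwitz F F' : hurwitz F F' -> twist_factorization F -> twist_factorization F'.
Proof.
elim=> {F F'} [F F' st|//|F F' F'' _ IH _ IH' /IH/IH' //] [E hF].
case: st E hF => [s t x y|s t x y|h s] E hF.
- split; first by rewrite /factorization E -!/(product _) !product_cat !product_cons !mulgA mulgVK.
  have hx : positive_half_twist x by apply: hF; rewrite mem_cat !inE eqxx ?orbT.
  have hy : positive_half_twist y by apply: hF; rewrite mem_cat !inE eqxx ?orbT.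
  move=> z; rewrite mem_cat !inE => /or4P [zs|/eqP ->|/eqP -> //|zt].
  + by apply: hF; rewrite mem_cat zs.
  + exact: half_conj.
  + by apply: hF; rewrite mem_cat !inE zt ?orbT.
- split; first by rewrite /factorization E -!/(product _) !product_cat !product_cons !mulgA mulgK.
  have hx : positive_half_twist x by apply: hF; rewrite mem_cat !inE eqxx ?orbT.
  have hy : positive_half_twist y by apply: hF; rewrite mem_cat !inE eqxx ?orbT.
  move=> z; rewrite mem_cat !inE => /or4P [zs|/eqP -> //|/eqP ->|zt].
  + by apply: hF; rewrite mem_cat zs.
  + by have := half_conj y^-1 hx; rewrite /cnj invgK.
  + by apply: hF; rewrite mem_cat !inE zt ?orbT.
- split.
    by rewrite /factorization -/(product _) (product_conj h) /product -E conj_Delta2r.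
  by move=> z /mapP [x xs ->]; apply/half_conj/hF.
Qed.

Lemma hurwitz_conj_map h F : hurwitz F [seq cnj h x | x <- F].
Proof. exact/rt_step/hurwitz_conj. Qed.

Lemma hurwitz_swap p u x y : hurwitz (p ++ x :: y :: u) (p ++ y :: cnj y^-1 x :: u).
Proof. by rewrite /cnj invgK; apply/rt_step/hurwitz_move_inv. Qed.

(** Only moves are used, so a prefix [p] may stand in front; global
    conjugations would not allow that. *)
Lemma hurwitz_front p s u x :
  hurwitz (p ++ s ++ x :: u) (p ++ x :: [seq cnj x^-1 z | z <- s] ++ u).
Proof.
elim: s p => [|z s IH] p /=; first exact: hurwitz_refl.
rewrite -cat_rcons; apply: hurwitz_trans (IH _) _.
by rewrite cat_rcons; apply: hurwitz_swap.
Qed.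

(** * Words in three half-twists *)

(** The half-twists [cor i] have as axes the vertices [e1], [e2], [e1 + e2] of a
    triangle of the Farey tessellation, in the cyclic order for which
    consecutive ones have product sigma1 sigma2. *)
Inductive corner := A | B | C.

Definition next_corner i := match i with A => B | B => C | C => A end.
Definition prev_corner i := match i with A => C | B => A | C => B end.

Definition cor i : B3 :=
  match i with A => sigma1 | B => sigma2 | C => cnj sigma1 sigma2 end.

Definition slope i : vec := match i with A => e1 | B => e2 | C => (1, 1)%Z end.

Definition delta : B3 := sigma1 * sigma2.

Lemma axis_cor i : axis (cor i) (slope i).
Proof.
case: i; [exact: axis_s1|exact: axis_s2|].
by have := axis_conj sigma1 axis_s2; rewrite lin_s1.
Qed.

Lemma corner_pair i : cor i * cor (next_corner i) = delta.
Proof.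
case: i => //=; last by rewrite /cnj mulgVK.
by rewrite /cnj !mulgA -sigma_braid mulgK.
Qed.

Lemma corner_delta i : cor i * delta = delta * cor (prev_corner i).
Proof. by rewrite -{1}(corner_pair (next_corner i)) mulgA corner_pair; case: i. Qed.

(** Conjugation by delta permutes the three letters cyclically, so a factor delta
    can be brought to the front of a word without leaving the alphabet. *)
Lemma product_slide s i u :
  product [seq cor j | j <- s ++ i :: next_corner i :: u] =
  delta * product [seq cor j | j <- [seq prev_corner j | j <- s] ++ u].
Proof.
elim: s => [|x s IH] /=; first by rewrite !product_cons mulgA corner_pair.
by rewrite !product_cons IH mulgA corner_delta -mulgA.
Qed.

Lemma hurwitz_corner_step p i u :
  hurwitz (p ++ cor i :: cor (next_corner i) :: u)
          (p ++ cor (next_corner i) :: cor (next_corner (next_corner i)) :: u).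
Proof.
suff -> : cor (next_corner (next_corner i)) = cnj (cor (next_corner i))^-1 (cor i) by apply: hurwitz_swap.
by rewrite /cnj invgK -mulgA corner_pair -(corner_pair (next_corner i)) mulKg.
Qed.

Lemma hurwitz_corner_pair p i u :
  hurwitz (p ++ cor i :: cor (next_corner i) :: u) (p ++ sigma1 :: sigma2 :: u).
Proof.
case: i; first exact: hurwitz_refl; last exact: (hurwitz_corner_step p C).
exact: hurwitz_trans (hurwitz_corner_step p B u) (hurwitz_corner_step p C u).
Qed.

Lemma hurwitz_slide p s i u :
  hurwitz (p ++ [seq cor j | j <- s ++ i :: next_corner i :: u])
          (p ++ sigma1 :: sigma2 :: [seq cor j | j <- [seq prev_corner j | j <- s] ++ u]).
Proof.
elim: s p => [|x s IH] p /=; first exact: hurwitz_corner_pair.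
rewrite -cat_rcons; apply: hurwitz_trans (IH _) _; rewrite cat_rcons.
apply: hurwitz_trans (hurwitz_swap _ _ _ _) _.
rewrite -cat_rcons -[X in hurwitz _ X]cat_rcons.
apply: hurwitz_trans (hurwitz_swap _ _ _ _) _; rewrite -conjM_act.
suff -> : cnj (sigma2^-1 * sigma1^-1) (cor x) = cor (prev_corner x) by apply: hurwitz_refl.
apply: conj_intro; rewrite -invgM -/delta; apply: (mulIg delta).
by rewrite mulgVK -mulgA corner_delta mulKg.
Qed.

Fixpoint ascent (w : seq corner) : bool :=
  if w is i :: u then
    (if u is j :: _ then match i, j with A, B | B, C | C, A => true | _, _ => false end
     else false) || ascent u
  else false.

Lemma ascentP w : ascent w -> exists s i u, w = s ++ i :: next_corner i :: u.
Proof.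
elim: w => //= i w IH; case: w IH => // j u IH /orP [ij|/IH [s [k [u' ->]]]]; last by exists (i :: s), k, u'.
by exists [::], i, u; move: ij {IH}; case: i; case: j.
Qed.

Fixpoint all_words (n : nat) (P : seq corner -> bool) : bool :=
  if n is m.+1 then
    [&& all_words m (fun w => P (A :: w)), all_words m (fun w => P (B :: w))
      & all_words m (fun w => P (C :: w))]
  else P [::].

Lemma all_wordsP n P w : all_words n P -> size w = n -> P w.
Proof.
elim: w n P => [|i w IH] [|n] P //= /and3P [hA hB hC] [sz].
by case: i; [apply: IH hA sz|apply: IH hB sz|apply: IH hC sz].
Qed.

Definition word_lin (w : seq corner) (v : vec) : vec :=
  foldr (fun i => transv (slope i)) v w.

Lemma lin_word w v : lin (product [seq cor i | i <- w]) v = word_lin w v.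
Proof.
elim: w => [|i w IH] /=; first by rewrite product_nil lin1.
by rewrite product_cons linM IH (axis_transv _ (axis_cor i)).
Qed.

Definition same (u v : vec) : bool := (u.1 =? v.1)%Z && (u.2 =? v.2)%Z.

(** The condition on the images of [e1] and [e2] says that the words [w] and [d]
    have the same matrix. *)
Definition ascent_test (d : seq corner) (w : seq corner) : bool :=
  same (word_lin w e1) (word_lin d e1) && same (word_lin w e2) (word_lin d e2) ==> ascent w.

(** Only the matrices are compared, which leaves 3^2, 3^4 or 3^6 words to be
    inspected. *)
Lemma ascent_exists k w : 0 < k <= 3 -> size w = k.*2 ->
  product [seq cor i | i <- w] = delta ^+ k -> ascent w.
Proof.
move=> k3 sz E.
have dE : delta ^+ k = product [seq cor i | i <- flatten (nseq k [:: A; B])].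
  elim: k {k3 sz E} => [|k IH]; first by rewrite expg0 product_nil.
  by rewrite expgS IH /= !product_cons /= mulgA.
have test : ascent_test (flatten (nseq k [:: A; B])) w.
  by apply: all_wordsP sz; case: k k3 {E dE} => [|[|[|[]]]] // _; vm_compute.
apply: (implyP test); rewrite -!lin_word E -dE /same.
by apply/andP; split; apply/andP; split; apply/Z.eqb_eq.
Qed.

(** Extract delta = sigma1 sigma2 repeatedly, starting from an ascent. *)
Lemma hurwitz_corners p k w : k <= 3 -> size w = k.*2 ->
  product [seq cor i | i <- w] = delta ^+ k ->
  hurwitz (p ++ [seq cor i | i <- w]) (p ++ flatten (nseq k [:: sigma1; sigma2])).
Proof.
elim: k p w => [|k IH] p w k3 sz E; first by rewrite (size0nil sz); apply: hurwitz_refl.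
have [//|s [i [u wE]]] := ascentP (ascent_exists _ sz E).
move: sz E; rewrite {}wE => sz E.
apply: hurwitz_trans (hurwitz_slide _ _ _ _) _ => /=.
rewrite -2!cat_rcons -[X in hurwitz _ X]cat_rcons -[X in hurwitz _ X]cat_rcons.
apply: IH; first exact: ltnW.
  by move: sz; rewrite !size_cat size_map /= !addnS doubleS => -[].
by move: E; rewrite product_slide expgS => /mulgI.
Qed.

Definition target : seq B3 := [:: sigma1; sigma2; sigma1; sigma1; sigma2; sigma1].

Lemma Delta2_delta : Delta ^+ 2 = delta ^+ 3.
Proof. by rewrite expg2 {2}/Delta sigma_braid /Delta /delta !expgS expg0 mulg1 !mulgA. Qed.

Lemma corners_target F : twist_factorization F -> {in F, forall x, exists i, x = cor i} ->
  hurwitz F target.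
Proof.
move=> fF hF.
have [w wE] : exists w, F = [seq cor i | i <- w].
  elim: F hF {fF} => [|x F IH] hF; first by exists [::].
  have [i xi] := hF x (mem_head _ _).
  have [z zF|w ->] := IH; first by apply: hF; rewrite inE zF orbT.
  by exists (i :: w); rewrite xi.
have := full_size fF; case: fF; rewrite wE size_map => E _ sz.
apply: hurwitz_trans (hurwitz_corners [::] (k := 3) _ sz _) _ => //.
  by rewrite /product -E Delta2_delta.
(* It remains to go from (sigma2, sigma1, sigma2) to (sigma1, sigma2, sigma1),
   through (B, B, C), (B, C, A) and (A, B, A). *)
pose p := [:: sigma1; sigma2; sigma1].
apply: (@hurwitz_trans (p ++ [:: cor B; cor C; cor A])).
  apply: hurwitz_trans (hurwitz_corner_step (rcons p sigma2) A [::]) _.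
  exact: (hurwitz_corner_step (rcons p sigma2) B [::]).
exact: (hurwitz_corner_pair p B [:: sigma1]).
Qed.

(** * Determinants of axes and reduction to three half-twists *)

(** Two axes of the same half-twist are parallel, as each is fixed by it. *)
Lemma axis_det_eq x v w : axis x v -> axis x w -> det v w = 0%Z.
Proof.
move=> xv xw; have := axis_transv v xv; rewrite (axis_transv v xw).
have [u wu] := axis_prim xw; rewrite /transv /addmul => -[d1 d2].
have vv : det v v = 0%Z by rewrite /det; lia.
have {}d1 : (det w v * w.1 = 0)%Z by rewrite vv in d1; lia.
have {}d2 : (det w v * w.2 = 0)%Z by rewrite vv in d2; lia.
have -> : det v w = (- (det w v * det w u))%Z by rewrite wu /det; lia.
have -> : (det w v * det w u = det w v * w.1 * u.2 - det w v * w.2 * u.1)%Z.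
  by rewrite {2}/det; lia.
by rewrite d1 d2.
Qed.

(** [g] is a power of sigma1. *)
Lemma shear_exists n : exists g,
  cnj g sigma1 = sigma1 /\ forall v, lin g v = (v.1 + n * v.2, v.2)%Z.
Proof.
elim/Z.peano_ind: n => [|n [g [gs gv]]|n [g [gs gv]]].
- by exists 1; split=> [|v]; rewrite ?conj1 ?lin1 //; apply: vecP => /=; lia.
- exists (sigma1 * g); split=> [|v]; first by rewrite conjM_act gs conj_id.
  by rewrite linM lin_s1 gv; apply: vecP => /=; lia.
- exists (sigma1^-1 * g); split=> [|v].
    by rewrite conjM_act gs -{2}(conj_id sigma1) conjVK.
  rewrite linM gv -[RHS](linVK sigma1) lin_s1 /=.
  by congr (lin _ _); apply: vecP => /=; lia.
Qed.

(** A power of sigma1 brings the axis of [y] to (-1, 2), as [a] is odd by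
    primitivity.  By the equality case of [winding_bound] the other four factors
    fix (0, 2), hence equal sigma2, and [y = sigma2^2 sigma1 sigma2^-2].  Moving
    two factors sigma2 to the left of [y] turns it into sigma1. *)
Lemma double_pair_target y a Q : twist_factorization (sigma1 :: y :: Q) -> axis y (a, 2)%Z ->
  hurwitz (sigma1 :: y :: Q) target.
Proof.
move=> fF ya.
have [[u1 u2]] := axis_prim ya; rewrite /det /= => au.
have [n aE] : exists n, a = (2 * n - 1)%Z.
  have [[k ak]|[k ak]] := Z.Even_or_Odd a; last by exists (k + 1)%Z; lia.
  by rewrite ak in au; lia.
have [g [gs gv]] := shear_exists (- n).
apply: hurwitz_trans (hurwitz_conj_map g _) _.
have := full_hurwitz (hurwitz_conj_map g _) fF.
rewrite /= gs; have := axis_conj g ya; rewrite gv /=.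
rewrite (_ : (a + - n * 2)%Z = (-1)%Z); last lia.
move: (cnj g y) [seq _ | _ <- _] => {y Q ya fF g gs gv n a aE au u1 u2} y Q ya fF.
have [E hF] := fF; case/half_twists_cons: hF => _ /half_twists_cons [hy hQ].
have Qs2 : {in Q, forall z, z = sigma2}.
  have {}E : sigma1 * y * product Q = Delta ^+ 2.
    by rewrite E -/(product _) !product_cons -[LHS]mulgA.
  have [//|_ fix_z] := winding_bound ya hQ E.
  move=> z zQ; have [[c d] zv] := half_axis (hQ z zQ).
  have := fix_z erefl z _ zQ zv; rewrite /det /= => c0.
  have [[c' d']] := axis_prim zv; rewrite /det /= => cd.
  have c_eq0 : c = 0%Z by lia.
  have [d1|d1] : (d = 1 \/ d = -1)%Z.
    by apply: (@Z.mul_eq_1 d (- c')); rewrite c_eq0 in cd; lia.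
    by apply: axis_inj zv _; rewrite c_eq0 d1; apply: axis_s2.
  by apply: axis_inj zv _; rewrite c_eq0 d1; apply: (axis_opp axis_s2).
have yE : y = cnj (sigma2 * sigma2) sigma1.
  apply: axis_inj ya _; have := axis_opp (axis_conj (sigma2 * sigma2) axis_s1).
  by rewrite linM !lin_s2.
have QE : Q = nseq 4 sigma2.
  have [sz] := full_size fF; rewrite -sz; apply/all_pred1P/allP => z zQ.
  by rewrite /= (Qs2 z zQ).
rewrite {}QE {}yE in fF *.
have moved : hurwitz (sigma1 :: cnj (sigma2 * sigma2) sigma1 :: nseq 4 sigma2)
    [:: sigma1; sigma2; sigma2; sigma1; sigma2; sigma2].
  have := hurwitz_front [:: sigma1] [:: cnj (sigma2 * sigma2) sigma1]
            [:: sigma2; sigma2; sigma2] sigma2.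
  rewrite /= conjM_act conjVK => h; apply: hurwitz_trans h _.
  have := hurwitz_front [:: sigma1; sigma2] [:: cnj sigma2 sigma1]
            [:: sigma2; sigma2] sigma2.
  by rewrite /= conjVK.
apply: (hurwitz_trans moved); apply: corners_target (full_hurwitz moved fF) _.
move=> z; rewrite !inE.
by case/or3P => [/eqP->|/eqP->|/or4P [/eqP->|/eqP->|/eqP->|/eqP->]];
  by [exists A | exists B].
Qed.

(** Conjugate [x] to sigma1 and choose the sign of the axis of [y]. *)
Lemma first_pair_bound x y v w Q : twist_factorization (x :: y :: Q) -> axis x v -> axis y w ->
  (-1 <= det v w <= 1)%Z \/ hurwitz (x :: y :: Q) target.
Proof.
move=> fF [h xh vh] yw.
have xE : cnj h^-1 x = sigma1 by rewrite xh conjVK.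
have wlog_pos w' : axis y w' -> (0 <= det v w')%Z ->
    (det v w' <= 1)%Z \/ hurwitz (x :: y :: Q) target.
  move=> {yw} yw.
  have := axis_conj h^-1 yw; rewrite -(det_lin h^-1) vh linVK.
  case: (lin h^-1 w') => a b; rewrite {1 2}/det /= => yab b0.
  have moved := hurwitz_conj_map h^-1 (x :: y :: Q).
  have := full_hurwitz moved fF; move: moved; rewrite /= xE => moved fF'.
  have [E /half_twists_cons [_ /half_twists_cons [_ hQ]]] := fF'.
  have {}E : sigma1 * cnj h^-1 y * product [seq cnj h^-1 z | z <- Q] = Delta ^+ 2.
    by rewrite E -/(product _) !product_cons -[LHS]mulgA.
  have [|b2 _] := winding_bound yab hQ E; first lia.
  have [b2'|b2'] : (b = 2 \/ b <= 1)%Z by lia.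
    right; apply: (hurwitz_trans moved).
    by rewrite b2' in yab; apply: double_pair_target fF' yab.
  by left; lia.
have [d|d] := Z.le_gt_cases 0 (det v w).
  by have [?|?] := wlog_pos w yw d; [left; lia|right].
have dN : det v (vopp w) = (- det v w)%Z by rewrite /det /=; lia.
have [||] := wlog_pos (vopp w) (axis_opp yw); [lia|by rewrite dN; left; lia|by right].
Qed.

Lemma hurwitz_pair s m u x y : exists Q,
  hurwitz (s ++ x :: m ++ y :: u) (x :: y :: Q).
Proof.
exists ([seq cnj y^-1 z | z <- [seq cnj x^-1 z | z <- s] ++ m] ++ u).
apply: hurwitz_trans (hurwitz_front [::] s (m ++ y :: u) x) _ => /=.
by rewrite catA; apply: (hurwitz_front [:: x]).
Qed.

Lemma pair_bound F : twist_factorization F -> ~ hurwitz F target ->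
  forall x y v w, x \in F -> y \in F -> axis x v -> axis y w -> (-1 <= det v w <= 1)%Z.
Proof.
move=> fF nF.
have ordered s m u x y v w : F = s ++ x :: m ++ y :: u ->
    axis x v -> axis y w -> (-1 <= det v w <= 1)%Z.
  move=> FE xv yw; have [Q FQ] := hurwitz_pair s m u x y.
  rewrite -FE in FQ.
  have [//|QT] := first_pair_bound (full_hurwitz FQ fF) xv yw.
  by case: nF; apply: hurwitz_trans FQ QT.
move=> x y v w xF; case/splitPr: xF ordered => s u ordered.
rewrite mem_cat inE => /or3P [ys|/eqP ->|yu] xv yw.
- case/splitPr: ys ordered => s1 s2 ordered.
  have := ordered s1 s2 u y x w v; rewrite -catA => /(_ erefl yw xv).
  by rewrite /det; lia.
- by rewrite (axis_det_eq xv yw).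
- by case/splitPr: yu ordered => u1 u2 ordered; apply: (ordered s u1 u2 x y).
Qed.

(** Otherwise all factors fix the axis of the first one, while Delta^2 acts
    as -1. *)
Lemma nonparallel_exists x F : twist_factorization (x :: F) -> exists y v w,
  [/\ y \in F, axis x v, axis y w & det v w <> 0%Z].
Proof.
move=> [E /half_twists_cons [hx hF]]; have [v xv] := half_axis hx.
apply: boolp.contrapT => none.
have fix_v : {in F, forall y, lin y v = v}.
  move=> y yF; have [w yw] := half_axis (hF y yF).
  have [d|d] := Z.eq_dec (det v w) 0; last by case: none; exists y, v, w.
  rewrite (axis_transv v yw) /transv (_ : det w v = 0%Z); last by move: d; rewrite /det; lia.
  by apply: vecP => /=; lia.
have vF : lin (product F) v = v.
  elim: F fix_v {E hF none} => [|y F IH] fix_v; first by rewrite product_nil lin1.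
  rewrite product_cons linM IH ?fix_v ?mem_head // => z zF.
  by apply: fix_v; rewrite inE zF orbT.
have := lin_Delta2 v; rewrite E -/(product _) product_cons linM vF (axis_transv v xv).
have [u] := axis_prim xv; case: v {xv fix_v vF none} => a b.
rewrite /transv /addmul /vopp /det /= => ab [a0 b0].
have {}a0 : a = 0%Z by nia. have {}b0 : b = 0%Z by nia.
by rewrite a0 b0 in ab; lia.
Qed.

Lemma axis_small x a b : axis x (a, b) -> (-1 <= a <= 1)%Z -> (-1 <= b <= 1)%Z ->
  (exists i, x = cor i) \/ axis x (1, -1)%Z.
Proof.
move=> xv a1 b1.
have up_to_sign w : axis x w \/ axis x (vopp w) -> axis x w.
  by case=> // /axis_opp; rewrite voppK.
have corner_axis i : axis x (slope i) \/ axis x (vopp (slope i)) ->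
    (exists i, x = cor i) \/ axis x (1, -1)%Z.
  by move=> /up_to_sign xi; left; exists i; apply: axis_inj xi (axis_cor i).
have [u] := axis_prim xv; rewrite /det /= => vu.
have [a_eq|[a_eq|a_eq]] : (a = -1 \/ a = 0 \/ a = 1)%Z by lia.
- have [b_eq|[b_eq|b_eq]] : (b = -1 \/ b = 0 \/ b = 1)%Z by lia.
  + by apply: (corner_axis C); right; move: xv; rewrite a_eq b_eq.
  + by apply: (corner_axis A); right; move: xv; rewrite a_eq b_eq.
  + by right; apply: up_to_sign; right; move: xv; rewrite a_eq b_eq.
- have [b_eq|[b_eq|b_eq]] : (b = -1 \/ b = 0 \/ b = 1)%Z by lia.
  + by apply: (corner_axis B); right; move: xv; rewrite a_eq b_eq.
  + by rewrite a_eq b_eq in vu; lia.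
  + by apply: (corner_axis B); left; move: xv; rewrite a_eq b_eq.
- have [b_eq|[b_eq|b_eq]] : (b = -1 \/ b = 0 \/ b = 1)%Z by lia.
  + by right; move: xv; rewrite a_eq b_eq.
  + by apply: (corner_axis A); left; move: xv; rewrite a_eq b_eq.
  + by apply: (corner_axis C); left; move: xv; rewrite a_eq b_eq.
Qed.

(** The determinants with [e1] and [e2] bound the coordinates of every axis, and
    (1, 1) and (1, -1) cannot both occur since their determinant is -2.  If
    (1, -1) occurs, conjugation by Delta, a quarter turn, replaces it by (1, 1)
    up to sign. *)
Lemma triangle_target F : twist_factorization F -> sigma1 \in F -> sigma2 \in F -> hurwitz F target.
Proof.
move=> fF s1F s2F; apply: boolp.contrapT => nF.
have bound := pair_bound fF nF.
have small z : z \in F -> (exists i, z = cor i) \/ axis z (1, -1)%Z.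
  move=> zF; have [[a b] zv] := half_axis (proj2 fF z zF).
  have := bound _ _ _ _ s1F zF axis_s1 zv; have := bound _ _ _ _ s2F zF axis_s2 zv.
  by rewrite /det /= => a1 b1; apply: axis_small zv _ _; lia.
have [[z zF zv]|none] := boolp.pselect (exists2 z, z \in F & axis z (1, -1)%Z).
  have moved := hurwitz_conj_map Delta F.
  apply: nF; apply: (hurwitz_trans moved).
  apply: corners_target (full_hurwitz moved fF) _ => _ /mapP [y yF ->].
  have [[[] yE]|yv] := small y yF.
  - by exists B; rewrite yE (conj_intro Delta_s1).
  - by exists A; rewrite yE (conj_intro Delta_s2).
  - have yv : axis y (1, 1)%Z by rewrite yE; apply: (axis_cor C).
    by have := bound _ _ _ _ zF yF zv yv; rewrite /det /=; lia.
  - exists C; apply: axis_inj _ (axis_cor C).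
    by have := axis_opp (axis_conj Delta yv); rewrite lin_Delta.
apply: nF; apply: corners_target => // z zF.
by have [//|zv] := small z zF; case: none; exists z.
Qed.

Lemma unimodular_pair_target x y v w Q : twist_factorization (x :: y :: Q) ->
  axis x v -> axis y w -> det v w = 1%Z -> hurwitz (x :: y :: Q) target.
Proof.
move=> fF [h xh vh] yw vw.
have := axis_conj h^-1 yw; move: vw; rewrite -(det_lin h^-1) vh linVK.
case: (lin h^-1 w) => a b; rewrite /det /= => b1 yab.
have [g [gs gv]] := shear_exists (- a).
have moved := hurwitz_conj_map (g * h^-1) (x :: y :: Q).
apply: (hurwitz_trans moved).
apply: triangle_target; first exact: full_hurwitz moved fF.
  by rewrite /= conjM_act xh conjVK gs mem_head.
have -> : sigma2 = cnj (g * h^-1) y; last by rewrite /= !inE eqxx orbT.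
rewrite conjM_act; apply: axis_inj axis_s2 _.
have := axis_conj g yab; rewrite gv /=.
by congr axis; apply: vecP => /=; lia.
Qed.

Theorem theorem4p24 (F : seq B3)
    (Ffact : factorization (Delta ^+ 2) F)
    (Fhalf : forall x : B3, x \in F -> positive_half_twist x) :
  hurwitz_equiv F [:: sigma1; sigma2; sigma1; sigma1; sigma2; sigma1].
Proof.
have fF : twist_factorization F by [].
rewrite -/target; apply: boolp.contrapT => nF.
case: F fF nF {Ffact Fhalf} => [|x F] fF nF; first by have := full_size fF.
have [y [v [w [yF xv yw vw0]]]] := nonparallel_exists fF.
have yxF : y \in x :: F by rewrite inE yF orbT.
have vw1 := pair_bound fF nF (mem_head _ _) yxF xv yw.
case/splitPr: yF fF nF {yxF} => s u fF nF.
have [Q FQ] := hurwitz_pair [::] s u x y.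
apply: nF; apply: (hurwitz_trans FQ); have {}fF := full_hurwitz FQ fF.
have [vw|vw] : (det v w = 1 \/ det v (vopp w) = 1)%Z by move: vw0 vw1; rewrite /det /=; lia.
  exact: unimodular_pair_target fF xv yw vw.
exact: unimodular_pair_target fF xv (axis_opp yw) vw.
Qed.
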